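(* Let $T=(R,V,W,S)$ be a Morita context and consider the following conditions. (1) $(R,V,W,S)$ is a semiprime ring. (2) $R$ and $S$ are semiprime rings. (3) $R$ or $S$ is a semiprime ring. Then (1) $\Rightarrow$ (2) $\Rightarrow$ (3). If moreover $VW=R$ and $WV=S$, then (3) $\Rightarrow$ (1).
   Context: All rings are associative with $1\neq 0$ and all modules are unitary. A Morita context is a 4-tuple $(R,V,W,S)$, where $R,S$ are rings, ${}_RV_S$ and ${}_SW_R$ are bimodules, with context products $V\times W\to R$, $(v,w)\mapsto vw$, and $W\times V\to S$, $(w,v)\mapsto wv$, such that $\begin{pmatrix} R & V\\ W & S\end{pmatrix}$ is an associative ring under the usual matrix operations; this ring is also denoted $(R,V,W,S)$. $VW$ and $WV$ denote the sets of finite sums of context products. A ring $A$ is semiprime if it has no nonzero nilpotent ideal, equivalently, for all $a\in A$, $aAa=0$ implies $a=0$. *)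

(* Defs.v *)
From HB Require Import structures.
From mathcomp Require Import all_boot all_algebra.
From mathcomp Require Import classical_sets.

Set Implicit Arguments.
Unset Strict Implicit.
Unset Printing Implicit Defensive.

Import GRing.Theory.
Local Open Scope classical_set_scope.
Local Open Scope ring_scope.

(* Finite sums of products: I J for two ideals of a ring, VW for the context
   products. *)
Definition sums_of_products (X Y : Type) (Z : nmodType) (mul : X -> Y -> Z)
    (I : set X) (J : set Y) : set Z :=
  [set z | exists n (x : 'I_n -> X) (y : 'I_n -> Y),
     [/\ forall i, I (x i), forall i, J (y i) & z = \sum_(i < n) mul (x i) (y i)]].

Definition two_sided_ideal (A : nzRingType) (I : set A) : Prop :=
  [/\ I 0,
      forall x y, I x -> I y -> I (x - y),
      forall a x, I x -> I (a * x)
    & forall a x, I x -> I (x * a)].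

(* I^0 = A, so that a nilpotency exponent is automatically positive as 1 != 0. *)
Definition ideal_pow (A : nzRingType) (I : set A) (n : nat) : set A :=
  iter n (sums_of_products *%R I) setT.

Definition nilpotent_ideal (A : nzRingType) (I : set A) : Prop :=
  exists n, ideal_pow I n = [set 0].

Definition semiprime (A : nzRingType) : Prop :=
  forall I : set A, two_sided_ideal I -> nilpotent_ideal I -> I = [set 0].

(* (R, S)-bimodules: the left action of R is the scaling of the lmodType, and
   [rscale v s] is the right action v s of S. *)
HB.mixin Record Lmodule_isBimodule (R S : nzRingType) V
    of GRing.Lmodule R V := {
  rscale : V -> S -> V;
  rscaleDl : forall (u v : V) (s : S), rscale (u + v) s = rscale u s + rscale v s;
  rscaleDr : forall (v : V) (s t : S), rscale v (s + t) = rscale v s + rscale v t;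
  rscaleA : forall (v : V) (s t : S), rscale v (s * t) = rscale (rscale v s) t;
  rscale1 : forall v : V, rscale v 1 = v;
  scale_rscaleA : forall (r : R) (v : V) (s : S),
    r *: (rscale v s) = rscale (r *: v) s
}.

#[short(type="bimodType")]
HB.structure Definition Bimodule (R S : nzRingType) :=
  { V of GRing.Lmodule R V & Lmodule_isBimodule R S V }.

(* (r, v, w, s) stands for the matrix with rows (r, v) and (w, s); addition is
   the componentwise addition of the product. *)
Definition context_mulmx (R S : nzRingType) (V : bimodType R S)
    (W : bimodType S R) (vw : V -> W -> R) (wv : W -> V -> S)
    (x y : R * V * W * S) : R * V * W * S :=
  let: (r, v, w, s) := x in
  let: (r', v', w', s') := y in
  (r * r' + vw v w', r *: v' + rscale v s',
   rscale w r' + s *: w', wv w v' + s * s').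

Record moritaContext (R S : nzRingType) (V : bimodType R S)
    (W : bimodType S R) := MoritaContext {
  vwprod : V -> W -> R;
  wvprod : W -> V -> S;
  context_mulmxA : associative (context_mulmx vwprod wvprod);
  context_mulmxDl :
    left_distributive (context_mulmx vwprod wvprod) +%R;
  context_mulmxDr :
    right_distributive (context_mulmx vwprod wvprod) +%R
}.

Definition morita_ring (R S : nzRingType) (V : bimodType R S)
    (W : bimodType S R) (T : moritaContext V W) : Type := R * V * W * S.

Section MoritaRing.
Variables (R S : nzRingType) (V : bimodType R S) (W : bimodType S R).
Variable T : moritaContext V W.

Let mulT := context_mulmx (vwprod T) (wvprod T).
Let oneT : R * V * W * S := (1, 0, 0, 1).

Lemma vwprod0r w : vwprod T 0 w = 0.
Proof.
have /(congr1 (fun x => x.1.1.1)) /= :=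
  context_mulmxDl T (0, 0, 0, 0) (0, 0, 0, 0) (0, 0, w, 0).
by rewrite !(mul0r, addr0, add0r) => /eqP; rewrite -subr_eq subrr => /eqP.
Qed.

Lemma vwprodr0 v : vwprod T v 0 = 0.
Proof.
have /(congr1 (fun x => x.1.1.1)) /= :=
  context_mulmxDr T (0, v, 0, 0) (0, 0, 0, 0) (0, 0, 0, 0).
by rewrite !(mul0r, addr0, add0r) => /eqP; rewrite -subr_eq subrr => /eqP.
Qed.

Lemma wvprod0r v : wvprod T 0 v = 0.
Proof.
have /(congr1 (fun x => x.2)) /= :=
  context_mulmxDl T (0, 0, 0, 0) (0, 0, 0, 0) (0, v, 0, 0).
by rewrite !(mul0r, addr0, add0r) => /eqP; rewrite -subr_eq subrr => /eqP.
Qed.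

Lemma wvprodr0 w : wvprod T w 0 = 0.
Proof.
have /(congr1 (fun x => x.2)) /= :=
  context_mulmxDr T (0, 0, w, 0) (0, 0, 0, 0) (0, 0, 0, 0).
by rewrite !(mul0r, addr0, add0r) => /eqP; rewrite -subr_eq subrr => /eqP.
Qed.

Lemma rscale0r (A B : nzRingType) (M : bimodType A B) (b : B) :
  rscale (0 : M) b = 0.
Proof.
have /eqP := rscaleDl (0 : M) 0 b.
by rewrite addr0 -subr_eq subrr => /eqP.
Qed.

Lemma rscaler0 (A B : nzRingType) (M : bimodType A B) (v : M) :
  rscale v (0 : B) = 0.
Proof.
have /eqP := rscaleDr v (0 : B) 0.
by rewrite addr0 -subr_eq subrr => /eqP.
Qed.

Lemma morita_mul1r : left_id oneT mulT.
Proof.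
case=> [[[r v] w] s]; rewrite /mulT /=.
by rewrite vwprod0r wvprod0r !rscale0r !mul1r !scale1r !addr0 !add0r.
Qed.

Lemma morita_mulr1 : right_id oneT mulT.
Proof.
case=> [[[r v] w] s]; rewrite /mulT /=.
by rewrite vwprodr0 wvprodr0 !rscale1 !mulr1 !scaler0 !addr0 !add0r.
Qed.

Lemma morita_1neq0 : oneT != 0.
Proof. by apply/eqP => -[/eqP]; rewrite oner_eq0. Qed.

HB.instance Definition _ := GRing.Zmodule.copy (morita_ring T) (R * V * W * S)%type.
HB.instance Definition _ := GRing.Zmodule_isNzRing.Build (morita_ring T)
  (context_mulmxA T) morita_mul1r morita_mulr1
  (context_mulmxDl T) (context_mulmxDr T) morita_1neq0.

Definition VW : set R := sums_of_products (vwprod T) setT setT.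
Definition WV : set S := sums_of_products (wvprod T) setT setT.

End MoritaRing.

(* Main.v *)
Require Import Defs.
From HB Require Import structures.
From mathcomp Require Import all_boot all_algebra.
From mathcomp Require Import classical_sets.

(** Semiprimeness is used in the elementwise form "a A a = 0 implies a = 0".
    It passes from T to the corners R and S because (r,0,0,0) T (r,0,0,0) is
    (r R r,0,0,0).  Conversely let R be semiprime, VW = R and WV = S.  If
    s S s = 0 then (v s w) R (v s w) = v s (w R v) s w = 0, so V s W = 0, hence
    s = 1 s 1 lies in W (V s W) V = 0; thus S is semiprime.  If now
    t = (r,v,w,s) satisfies t T t = 0, testing on the two diagonal corners
    gives r = 0 and s = 0, and on the off-diagonal ones w V w = 0 and
    v W v = 0.  Then (w v') S (w v') = 0, so w V = 0 and w = w 1 lies in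
    (w V) W = 0; likewise v = 0. *)

Set Implicit Arguments.
Unset Strict Implicit.
Unset Printing Implicit Defensive.

Import GRing.Theory.
Local Open Scope classical_set_scope.
Local Open Scope ring_scope.

(** * Semiprimeness: from nilpotent ideals to elements *)

Lemma sums_of_products_ind (X Y : Type) (Z : nmodType) (mul : X -> Y -> Z)
    (I : set X) (J : set Y) (K : set Z) :
  K 0 -> (forall x y, K x -> K y -> K (x + y)) ->
  (forall x y, I x -> J y -> K (mul x y)) ->
  sums_of_products mul I J `<=` K.
Proof.
move=> K0 KD Kmul _ [n [x [y [Ix Jy ->]]]].
by apply: (big_ind K) => // i _; apply: Kmul.
Qed.

Lemma sums_of_products_mul (X Y : Type) (Z : nmodType) (mul : X -> Y -> Z)
    (I : set X) (J : set Y) x y :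
  I x -> J y -> sums_of_products mul I J (mul x y).
Proof.
move=> Ix Jy; exists 1, (fun=> x), (fun=> y); split => //.
by rewrite big_ord1.
Qed.

Section ElementwiseSemiprime.
Variable A : nzRingType.

Definition elementwise_semiprime :=
  forall a : A, (forall x, a * x * a = 0) -> a = 0.

Lemma two_sided_idealD (I : set A) x y :
  two_sided_ideal I -> I x -> I y -> I (x + y).
Proof.
case=> I0 IB _ _ Ix Iy; rewrite -[y]opprK; apply: (IB) => //.
by rewrite -sub0r; apply: IB.
Qed.

Lemma ideal_powS_sub (I : set A) n :
  two_sided_ideal I -> ideal_pow I n.+1 `<=` I.
Proof.
move=> idI; have [I0 _ _ Ir] := idI; apply: sums_of_products_ind => //.
  by move=> x y; apply: two_sided_idealD.
by move=> x y Ix _; apply: Ir.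
Qed.

(** Descent on the exponent: for a in I^(n+1), a x a = (a x) a lies in I I^(n+1) = I^(n+2) = 0, so a
    = 0 and already I^(n+1) = 0. *)
Lemma elementwise_semiprime_nilpotent (I : set A) n :
  elementwise_semiprime -> two_sided_ideal I ->
  ideal_pow I n `<=` [set 0] -> I `<=` [set 0].
Proof.
move=> spA idI; have [_ _ _ Ir] := idI.
case: n => [I0 x _|n]; first exact: I0.
elim: n => [I1 x Ix|n IHn In2].
  by rewrite -[x]mulr1; apply: I1; apply: sums_of_products_mul.
apply: IHn => a Ia; apply: spA => x; apply: In2.
apply: sums_of_products_mul => //.
by apply: Ir; apply: ideal_powS_sub Ia.
Qed.

(** The intersection form avoids explicit sums of x a y: membership is used by choosing a suitable
    [J]. *)
Definition generated_ideal (a : A) : set A :=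
  [set z | forall J, two_sided_ideal J -> J a -> J z].

Lemma generated_ideal_ideal a : two_sided_ideal (generated_ideal a).
Proof.
split=> [J [] //|x y Ix Iy J idJ Ja|b x Ix J idJ Ja|b x Ix J idJ Ja].
- by have [_ JB _ _] := idJ; apply: JB; [apply: Ix|apply: Iy].
- by have [_ _ Jl _] := idJ; apply: Jl; apply: Ix.
- by have [_ _ _ Jr] := idJ; apply: Jr; apply: Ix.
Qed.

(** The u with u A a = 0 form an ideal containing a, hence containing y. Then the u with y A u = 0
    form an ideal containing a, hence containing z. *)
Lemma generated_ideal_mul0 a :
  (forall x, a * x * a = 0) ->
  forall y z, generated_ideal a y -> generated_ideal a z -> y * z = 0.
Proof.
move=> a0 y z Iy.
have ya t : y * t * a = 0.
  apply: (Iy [set u | forall t, u * t * a = 0]); last exact: a0.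
  split=> [s|u v u0 v0 s|b u u0 s|b u u0 s] /=.
  - by rewrite !mul0r.
  - by rewrite !mulrBl u0 v0 subrr.
  - by rewrite -!mulrA [u * _]mulrA u0 mulr0.
  - by rewrite -(mulrA u).
move=> Iz; rewrite -[y]mulr1.
apply: (Iz [set u | forall t, y * t * u = 0]); last exact: ya.
split=> [s|u v u0 v0 s|b u u0 s|b u u0 s] /=.
- by rewrite mulr0.
- by rewrite mulrBr u0 v0 subrr.
- by rewrite mulrA -(mulrA y).
- by rewrite mulrA u0 mul0r.
Qed.

Lemma semiprimeP : semiprime A <-> elementwise_semiprime.
Proof.
split=> [spA a a0|spA I idI [n In]]; last first.
  have [I0 _ _ _] := idI; apply/seteqP; split=> [|_ -> //].
  by apply: (elementwise_semiprime_nilpotent (n := n)) => //; rewrite In.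
suff gen0 : generated_ideal a = [set 0].
  have : generated_ideal a a by move=> J.
  by rewrite gen0.
have idI := generated_ideal_ideal a; have [I0 _ _ _] := idI.
(* As I^0 = A, the square is I (I A), and I A is contained in I. *)
apply: spA => //; exists 2; apply/seteqP; split.
  apply: sums_of_products_ind => //= [x y -> ->|x y Ix Iy].
    by rewrite addr0.
  by apply: (generated_ideal_mul0 a0) => //; apply: (ideal_powS_sub (n := 0) idI).
move=> _ ->; rewrite -[0](mulr0 0); apply: sums_of_products_mul => //.
by rewrite -[0](mulr0 0); apply: sums_of_products_mul.
Qed.

End ElementwiseSemiprime.

(** * Exchanging the roles of R and S *)

Definition swap_entries (X Y Z U : Type) (x : X * Y * Z * U) : U * Z * Y * X :=
  let: (r, v, w, s) := x in (s, w, v, r).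

Section Swap.
Variables (R S : nzRingType) (V : bimodType R S) (W : bimodType S R).
Variable T : moritaContext V W.

Lemma swap_entriesK :
  cancel (@swap_entries S W V R) (@swap_entries R V W S).
Proof. by move=> [[[]]]. Qed.

(** The swap is conjugation by the antidiagonal permutation matrix; it carries the ring axioms over
    to (S, W, V, R). *)
Lemma swap_entries_mul (x y : R * V * W * S) :
  context_mulmx (wvprod T) (vwprod T) (swap_entries x) (swap_entries y)
  = swap_entries (context_mulmx (vwprod T) (wvprod T) x y).
Proof.
case: x y => [[[r v] w] s] [[[r' v'] w'] s'] /=.
by congr (_, _, _, _); rewrite addrC.
Qed.

Lemma swap_entriesD (x y : R * V * W * S) :
  swap_entries (x + y) = swap_entries x + swap_entries y.
Proof. by case: x y => [[[? ?] ?] ?] [[[? ?] ?] ?]. Qed.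

Let mulT' := context_mulmx (wvprod T) (vwprod T).

Lemma swap_mulA : associative mulT'.
Proof.
move=> x y z; rewrite -[x]swap_entriesK -[y]swap_entriesK -[z]swap_entriesK.
by rewrite /mulT' !swap_entries_mul context_mulmxA.
Qed.

Lemma swap_mulDl : left_distributive mulT' +%R.
Proof.
move=> x y z; rewrite -[x]swap_entriesK -[y]swap_entriesK -[z]swap_entriesK.
by rewrite /mulT' -swap_entriesD !swap_entries_mul context_mulmxDl swap_entriesD.
Qed.

Lemma swap_mulDr : right_distributive mulT' +%R.
Proof.
move=> x y z; rewrite -[x]swap_entriesK -[y]swap_entriesK -[z]swap_entriesK.
by rewrite /mulT' -swap_entriesD !swap_entries_mul context_mulmxDr swap_entriesD.
Qed.

Definition morita_swap : moritaContext W V :=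
  MoritaContext swap_mulA swap_mulDl swap_mulDr.

End Swap.

(** * Compatibility of the context products with the actions *)

Section ContextProducts.
Variables (R S : nzRingType) (V : bimodType R S) (W : bimodType S R).
Variable T : moritaContext V W.
Implicit Types (r : R) (v : V) (w : W) (s : S).

Local Notation vw := (vwprod T).
Local Notation wv := (wvprod T).

Definition morita_simp :=
  (vwprod0r T, vwprodr0 T, wvprod0r T, wvprodr0 T, @rscale0r R S V,
   @rscale0r S R W, @rscaler0 R S V, @rscaler0 S R W, @scale0r R V,
   @scale0r S W, @scaler0 R V, @scaler0 S W, @mul0r R, @mulr0 R, @mul0r S,
   @mulr0 S, @addr0 R, @add0r R, @addr0 S, @add0r S, @addr0 V, @add0r V,
   @addr0 W, @add0r W).

(** Associativity for three matrices with one nonzero entry each, read at one entry; the next two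
    identities arise likewise. *)
Lemma vwprod_scalel r v w : vw (r *: v) w = r * vw v w.
Proof.
have /(congr1 (fun x => x.1.1.1)) :=
  context_mulmxA T (r, 0, 0, 0) (0, v, 0, 0) (0, 0, w, 0).
by rewrite /= !morita_simp.
Qed.

Lemma vwprod_rscaler v w r : vw v (rscale w r) = vw v w * r.
Proof.
have /(congr1 (fun x => x.1.1.1)) :=
  context_mulmxA T (0, v, 0, 0) (0, 0, w, 0) (r, 0, 0, 0).
by rewrite /= !morita_simp.
Qed.

Lemma vwprod_scale v w v' : vw v w *: v' = rscale v (wv w v').
Proof.
have /(congr1 (fun x => x.1.1.2)) :=
  context_mulmxA T (0, v, 0, 0) (0, 0, w, 0) (0, v', 0, 0).
by rewrite /= !morita_simp.
Qed.

End ContextProducts.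

Lemma wvprod_rscaler (R S : nzRingType) (V : bimodType R S) (W : bimodType S R)
    (T : moritaContext V W) (w : W) (v : V) (s : S) :
  wvprod T w (rscale v s) = wvprod T w v * s.
Proof. exact: (vwprod_rscaler (morita_swap T)). Qed.

(** * Consequences of WV = S for R semiprime *)

Section SurjectiveContext.
Variables (R S : nzRingType) (V : bimodType R S) (W : bimodType S R).
Variable T : moritaContext V W.
Hypothesis WVT : WV T = setT.
Hypothesis spR : elementwise_semiprime R.

Local Notation vw := (vwprod T).
Local Notation wv := (wvprod T).

(** Replaces writing 1 as a sum of products w v: an additive condition is checked on products, then
    used at 1. *)
Lemma WV_full_ind (K : set S) :
  K 0 -> (forall s t, K s -> K t -> K (s + t)) ->
  (forall w v, K (wv w v)) -> forall s, K s.
Proof.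
move=> K0 KD Kwv s; have : WV T s by rewrite WVT.
by apply: sums_of_products_ind => // w v _ _; apply: Kwv.
Qed.

Lemma elementwise_semiprime_transfer : elementwise_semiprime S.
Proof.
move=> s s0.
have vsw0 v w : vw (rscale v s) w = 0.
  (* (v s w) r (v s w) = v (s ((w r) v) s) w, with middle factor in s S s = 0. *)
  apply: spR => r; rewrite -vwprod_rscaler -vwprod_scalel vwprod_scale.
  rewrite wvprod_rscaler -rscaleA mulrA s0 rscaler0.
  exact: vwprod0r.
(* Expanding a 1 on the left of s gives terms w' ((v' s) w) v = 0; below, a 1 on the right of s
   finishes. *)
have swv0 w v : s * wv w v = 0.
  suff kill t : t * (s * wv w v) = 0 by rewrite -[LHS]mul1r.
  apply: (WV_full_ind (K := [set t | t * (s * wv w v) = 0])) => /=.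
  - by rewrite mul0r.
  - by move=> x y x0 y0; rewrite mulrDl x0 y0 addr0.
  - move=> w' v'; rewrite -wvprod_rscaler rscaleA.
    by rewrite -vwprod_scale vsw0 scale0r wvprodr0.
suff kill t : s * t = 0 by rewrite -[s]mulr1.
apply: (WV_full_ind (K := [set t | s * t = 0])) => //=.
- by rewrite mulr0.
- by move=> x y x0 y0; rewrite mulrDr x0 y0 addr0.
Qed.

(** (v w) r (v w) = ((v (w r)) v) w = 0 yields v W = 0, and then v (w v') = (v w) v' = 0 yields v 1
    = 0. *)
Lemma offdiagonal_eq0 (v : V) : (forall w, vw v w *: v = 0) -> v = 0.
Proof.
move=> v0; have vw0 w : vw v w = 0.
  apply: spR => r.
  by rewrite -vwprod_rscaler -vwprod_scalel v0 vwprod0r.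
suff kill t : rscale v t = 0 by rewrite -[v](rscale1 (S := S)).
apply: (WV_full_ind (K := [set t | rscale v t = 0])) => /=.
- exact: rscaler0.
- by move=> x y x0 y0; rewrite rscaleDr x0 y0 addr0.
- by move=> w v'; rewrite -vwprod_scale vw0 scale0r.
Qed.

End SurjectiveContext.

(** * Passing between the Morita ring and its corners *)

Section MoritaSemiprime.
Variables (R S : nzRingType) (V : bimodType R S) (W : bimodType S R).
Variable T : moritaContext V W.

Local Notation ctx_mul := (context_mulmx (vwprod T) (wvprod T)).

Lemma elementwise_semiprime_corners :
  elementwise_semiprime (morita_ring T) ->
  elementwise_semiprime R /\ elementwise_semiprime S.
Proof.
move=> spT; split=> a a0.
  suff /(congr1 (fun x => x.1.1.1)) :
    ((a, 0, 0, 0) : morita_ring T) = 0 by [].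
  apply: spT => -[[[r v] w] s].
  change (ctx_mul (ctx_mul (a, 0, 0, 0) (r, v, w, s)) (a, 0, 0, 0) = 0).
  by rewrite /= !morita_simp a0.
suff /(congr1 (fun x => x.2)) :
  ((0, 0, 0, a) : morita_ring T) = 0 by [].
apply: spT => -[[[r v] w] s].
change (ctx_mul (ctx_mul (0, 0, 0, a) (r, v, w, s)) (0, 0, 0, a) = 0).
by rewrite /= !morita_simp a0.
Qed.

Lemma elementwise_semiprime_morita_ring :
  VW T = setT -> WV T = setT ->
  elementwise_semiprime R -> elementwise_semiprime S ->
  elementwise_semiprime (morita_ring T).
Proof.
move=> VWT WVT spR spS [[[r v] w] s] t0.
have {}t0 x : ctx_mul (ctx_mul (r, v, w, s) x) (r, v, w, s) = 0 by exact: t0.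
have -> : r = 0.
  apply: spR => x; have /(congr1 (fun x => x.1.1.1)) := t0 (x, 0, 0, 0).
  by rewrite /= !morita_simp.
have -> : s = 0.
  apply: spS => x; have /(congr1 (fun x => x.2)) := t0 (0, 0, 0, x).
  by rewrite /= !morita_simp.
(* With x in position (2,1), the (1,2) entry of t x t is (v x) v. *)
have -> : v = 0.
  apply: (offdiagonal_eq0 WVT spR) => x.
  have /(congr1 (fun x => x.1.1.2)) := t0 (0, 0, x, 0).
  by rewrite /= !morita_simp.
have -> // : w = 0.
(* In the swapped context [WV] is the [VW] of [T]. *)
apply: (offdiagonal_eq0 (T := morita_swap T) VWT spS) => x.
have /(congr1 (fun x => x.1.2)) := t0 (0, x, 0, 0).
by rewrite /= !morita_simp.
Qed.

End MoritaSemiprime.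

Theorem theorem2p14 (R S : nzRingType) (V : bimodType R S) (W : bimodType S R)
    (T : moritaContext V W) :
  [/\ semiprime (morita_ring T) -> semiprime R /\ semiprime S,
      semiprime R /\ semiprime S -> semiprime R \/ semiprime S
    & VW T = setT -> WV T = setT ->
      semiprime R \/ semiprime S -> semiprime (morita_ring T)].
Proof.
split=> [/semiprimeP spT|[spR _]|VWT WVT spRS]; [|by left|].
  have [spR spS] := elementwise_semiprime_corners spT.
  by split; apply/semiprimeP.
apply/semiprimeP.
(* The missing ring is reached from R by WV = S, and from S by VW = R. *)
case: spRS => /semiprimeP sp; apply: elementwise_semiprime_morita_ring => //.
  exact: (elementwise_semiprime_transfer WVT).
exact: (elementwise_semiprime_transfer (T := morita_swap T) VWT).
Qed.
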